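(* Let $-1<x<1$ and let $f:[-1,1]\to\mathbb{R}$ be a three times differentiable function with $f'''$ bounded on $[-1,1]$. Then $$\left|\int_{-1}^1 f(t)\,dt-\frac13\left[\frac{1+3x}{1+x}f(-1)+\frac{4}{1-x^2}f(x)+\frac{1-3x}{1-x}f(1)\right]\right|\le M_2(x)\,\|f'''\|_\infty,$$ where $$M_2(x)=\begin{cases}\dfrac{8x^5+49x^4-60x^3+22x^2-4x+1}{36(1-x)^4}, & 0\le x<\dfrac13,\\[3mm] \dfrac{2x}{9}, & \dfrac13\le x<1,\end{cases}$$ and $M_2(-x)=M_2(x)$ for $-1<x<1$.
   Context: The norm is $\|g\|_\infty=\sup_{t\in[-1,1]}|g(t)|$. *)

(* Defs.v *)
From Stdlib Require Import Reals.
From Coquelicot Require Import Coquelicot.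
Open Scope R_scope.

(* A function on [-1,1] is represented by a total function on R; every notion
   below depends only on its values on [-1,1]. *)
Definition I11 (t : R) : Prop := -1 <= t <= 1.

(* [D_in g d I11 t] is differentiation relative to the set [I11], so it is
   one-sided at -1 and at 1. *)
Definition is_derivative_on_I11 (g d : R -> R) : Prop :=
  forall t : R, I11 t -> D_in g d I11 t.

Definition bounded_on_I11 (g : R -> R) : Prop :=
  exists B : R, forall t : R, I11 t -> Rabs (g t) <= B.

(* [Lub_Rbar] takes values in the extended reals; its projection to R is the
   supremum whenever [g] is bounded on [-1,1]. *)
Definition sup_norm (g : R -> R) : R :=
  real (Lub_Rbar (fun y : R => exists t : R, I11 t /\ y = Rabs (g t))).

Definition M2_nonneg (x : R) : R :=
  if Rlt_dec x (1 / 3)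
  then (8 * x ^ 5 + 49 * x ^ 4 - 60 * x ^ 3 + 22 * x ^ 2 - 4 * x + 1)
       / (36 * (1 - x) ^ 4)
  else 2 * x / 9.

Definition M2 (x : R) : R :=
  if Rle_dec 0 x then M2_nonneg x else M2_nonneg (- x).

(* Main.v *)
Require Import Defs.
From Stdlib Require Import Reals Lra.
From Coquelicot Require Import Coquelicot.
Open Scope R_scope.

(** The rule is exact on polynomials of degree two, so its error has a Peano
    kernel [K]: with [t1 = 2x/(1+x)] and [t0 = 2x/(1-x)],
    [K t = (t+1)^2 (t1-t) / 6] on [[-1,x]] and [K t = (t-1)^2 (t0-t) / 6] on
    [[x,1]].  For [0 <= x] we have [x <= t1] and [x <= t0], so [K] changes sign
    at most once, at [t0], and only when [x < 1/3]; hence [M2 x] is the integral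
    of [|K|].  Since [f'''] need not be integrable, the error is never written
    as an integral of [K f''']: on each piece, [K f'' - K' f' + K'' f] plus a
    primitive of [f] has derivative [K f'''], and the mean value theorem compares
    it with [||f'''||] times a primitive of [|K|].  Negative [x] follows by
    reflection. *)

(** * Extension from [-1,1] to the real line *)

Definition clamp (t : R) : R := Rmax (-1) (Rmin 1 t).

Lemma clamp_I11 (t : R) : I11 (clamp t).
Proof.
unfold I11, clamp, Rmax, Rmin; repeat destruct Rle_dec; lra.
Qed.

Lemma clamp_id (t : R) : I11 t -> clamp t = t.
Proof.
unfold I11, clamp, Rmax, Rmin; repeat destruct Rle_dec; lra.
Qed.

Lemma clamp_contraction (s t : R) : Rabs (clamp s - clamp t) <= Rabs (s - t).
Proof.
unfold clamp, Rmax, Rmin; repeat destruct Rle_dec; split_Rabs; lra.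
Qed.

(** Relative differentiability gives relative continuity, and [clamp] is 1-Lipschitz into [-1,1];
    the extension is thus two-sided continuous even at the endpoints. *)
Lemma is_derivative_on_I11_continuity_clamp (g d : R -> R) :
  is_derivative_on_I11 g d ->
  forall t, continuity_pt (fun s => g (clamp s)) t.
Proof.
intros Hg t eps Heps.
destruct (cont_deriv _ _ _ _ (Hg _ (clamp_I11 t)) eps Heps) as [alp [Halp H]].
exists alp; split; [exact Halp|].
intros s [_ Hs]; simpl in Hs |- *; unfold Rdist in Hs |- *.
(* The relative limit only concerns points other than [clamp t], but [clamp] is not injective. *)
destruct (Req_dec (clamp t) (clamp s)) as [E|E].
- rewrite E, Rminus_diag, Rabs_R0; exact Heps.
- apply H; split.
  + split; [apply clamp_I11|exact E].
  + simpl; unfold Rdist; generalize (clamp_contraction s t); lra.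
Qed.

Lemma is_derivative_on_I11_is_derive_clamp (g d : R -> R) :
  is_derivative_on_I11 g d ->
  forall t, -1 < t < 1 -> is_derive (fun s => g (clamp s)) t (d t).
Proof.
intros Hg t Ht.
apply is_derive_Reals; intros eps Heps.
destruct (Hg t ltac:(unfold I11; lra) eps Heps) as [alp [Halp H]].
simpl in H; unfold Rdist in H.
(* The radius also keeps [t + h] inside [-1,1], where [clamp] is the identity. *)
assert (Hd : 0 < Rmin alp (Rmin (1 - t) (t + 1))).
{ repeat apply Rmin_pos; lra. }
exists (mkposreal _ Hd); simpl; intros h Hh0 Hh.
assert (Hh1 : Rabs h < alp).
{ apply Rlt_le_trans with (1 := Hh), Rmin_l. }
assert (Hh2 : Rabs h < 1 - t /\ Rabs h < t + 1).
{ split; apply Rlt_le_trans with (1 := Hh);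
    apply Rle_trans with (1 := Rmin_r _ _); [apply Rmin_l|apply Rmin_r]. }
assert (Hth : I11 (t + h)) by (unfold I11; split_Rabs; lra).
rewrite !clamp_id; [|unfold I11; lra|exact Hth].
specialize (H (t + h)).
replace (t + h - t) with h in H by ring.
apply H; repeat split; try apply Hth; lra.
Qed.

(** The least upper bound lies between two reals, so it is finite and [real] does not replace it by
    a default. *)
Lemma bounded_on_I11_le_sup_norm (g : R -> R) :
  bounded_on_I11 g -> forall t, I11 t -> Rabs (g t) <= sup_norm g.
Proof.
intros [B HB] t Ht; unfold sup_norm.
set (E := fun y => _).
destruct (Lub_Rbar_correct E) as [Hub Hlub].
assert (H1 : Rbar_le (Rabs (g t)) (Lub_Rbar E)).
{ apply Hub; exists t; auto. }
assert (H2 : Rbar_le (Lub_Rbar E) B).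
{ apply Hlub; intros y [s [Hs ->]]; apply HB, Hs. }
destruct (Lub_Rbar E); simpl in *; tauto.
Qed.

(** * Peano kernel estimate for nonnegative nodes *)

Section Kernel.

Variables (F F1 F2 F3 : R -> R) (M : R).
Hypotheses (CF : forall t, continuity_pt F t)
  (CF1 : forall t, continuity_pt F1 t)
  (CF2 : forall t, continuity_pt F2 t)
  (DF : forall t, -1 < t < 1 -> is_derive F t (F1 t))
  (DF1 : forall t, -1 < t < 1 -> is_derive F1 t (F2 t))
  (DF2 : forall t, -1 < t < 1 -> is_derive F2 t (F3 t))
  (BF3 : forall t, -1 <= t <= 1 -> Rabs (F3 t) <= M).

Lemma ex_RInt_F (a b : R) : ex_RInt F a b.
Proof.
apply (ex_RInt_continuous (V := R_CompleteNormedModule)).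
intros; apply continuity_pt_filterlim, CF.
Qed.

Lemma is_derive_RInt_F (t : R) : is_derive (fun s => RInt F (-1) s) t (F t).
Proof.
apply (is_derive_RInt (V := R_NormedModule)) with (a := -1).
- apply filter_forall; intros s; apply (RInt_correct (V := R_CompleteNormedModule)), ex_RInt_F.
- apply continuity_pt_filterlim, CF.
Qed.

(** One formula for both pieces: [e] is the endpoint -1 or 1, and [r] is [t1] or [t0]. *)
Definition kernel (e r t : R) : R := (t - e) ^ 2 * (r - t) / 6.

Definition kernel_primitive (e r t : R) : R :=
  (t - e) ^ 3 * (r - e) / 18 - (t - e) ^ 4 / 24.

(** The coefficients of [F1] and [F] are -K' and K''. Since K''' = -1, differentiation telescopes to
    K [F3] once the integral of [F] is added. *)
Definition by_parts (e r t : R) : R :=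
  kernel e r t * F2 t
  - ((t - e) * (r - e) / 3 - (t - e) ^ 2 / 2) * F1 t
  + ((r - e) / 3 - (t - e)) * F t + RInt F (-1) t.

Lemma is_derive_kernel_primitive (e r t : R) :
  is_derive (kernel_primitive e r) t (kernel e r t).
Proof.
unfold kernel_primitive, kernel; auto_derive; [exact I|field].
Qed.

Lemma is_derive_by_parts (e r t : R) :
  -1 < t < 1 -> is_derive (by_parts e r) t (kernel e r t * F3 t).
Proof.
intros Ht.
generalize (DF t Ht) (DF1 t Ht) (DF2 t Ht) (is_derive_RInt_F t).
unfold by_parts, kernel.
generalize (RInt F (-1)); intros P H H1 H2 HP.
auto_derive.
- repeat split; eexists; eassumption.
- replace (Derive (fun s : R => F s) t) with (F1 t)
    by (symmetry; apply is_derive_unique, H).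
  replace (Derive (fun s : R => F1 s) t) with (F2 t)
    by (symmetry; apply is_derive_unique, H1).
  replace (Derive (fun s : R => F2 s) t) with (F3 t)
    by (symmetry; apply is_derive_unique, H2).
  replace (Derive (fun s : R => P s) t) with (F t)
    by (symmetry; apply is_derive_unique, HP).
  field.
Qed.

Lemma continuity_by_parts (e r t : R) : continuity_pt (by_parts e r) t.
Proof.
assert (HP : continuity_pt (fun s => RInt F (-1) s) t).
{ apply derivable_continuous_pt; exists (F t).
  apply is_derive_Reals, is_derive_RInt_F. }
assert (Hpoly : forall (p : R -> R), ex_derive p t -> continuity_pt p t).
{ intros p [l Hl]; apply derivable_continuous_pt; exists l.
  apply is_derive_Reals, Hl. }
unfold by_parts, kernel.
apply continuity_pt_plus; [|exact HP].
apply continuity_pt_plus; [apply continuity_pt_minus|];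
  apply continuity_pt_mult; try apply CF; try apply CF1; try apply CF2;
  apply Hpoly; auto_derive; exact I.
Qed.

(** Here [s] is the sign of the kernel on [a,b]. For d = 1 and d = -1, [s * M] times the primitive
    minus d times [by_parts] has derivative s K (M - s d [F3]) >= 0. *)
Lemma by_parts_bound (s e r a b : R) :
  -1 <= a <= b -> b <= 1 ->
  (forall t, a <= t <= b -> 0 <= s * (r - t)) -> s = 1 \/ s = -1 ->
  Rabs (by_parts e r b - by_parts e r a)
  <= s * M * (kernel_primitive e r b - kernel_primitive e r a).
Proof.
intros Ha Hb HK Hs.
assert (Hsigned : forall d, d = 1 \/ d = -1 ->
  0 <= s * M * (kernel_primitive e r b - kernel_primitive e r a)
       - d * (by_parts e r b - by_parts e r a)).
{ intros d Hd.
  destruct (MVT_gen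
    (fun t => s * M * kernel_primitive e r t - d * by_parts e r t) a b
    (fun t => s * M * kernel e r t - d * (kernel e r t * F3 t)))
    as [c [Hc Heq]]; rewrite ?Rmin_left, ?Rmax_right in * by lra.
  - intros t Ht.
    apply (is_derive_minus (V := R_NormedModule)).
    + apply (is_derive_scal (kernel_primitive e r)), is_derive_kernel_primitive.
    + apply (is_derive_scal (by_parts e r)), is_derive_by_parts; lra.
  - intros t Ht.
    apply continuity_pt_minus;
      apply (continuity_pt_scal); [|apply continuity_by_parts].
    apply derivable_continuous_pt; exists (kernel e r t).
    apply is_derive_Reals, is_derive_kernel_primitive.
  (* The mean value point may be an endpoint; the bound and the sign hold there too. *)
  - assert (H3 := BF3 c ltac:(lra)); specialize (HK c Hc).
    assert (HKc : 0 <= s * kernel e r c).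
    { generalize (Rmult_le_pos _ _ (pow2_ge_0 (c - e)) HK); unfold kernel; lra. }
    assert (0 <= s * M * kernel e r c - d * (kernel e r c * F3 c)).
    { replace (s * M * kernel e r c - d * (kernel e r c * F3 c))
        with ((s * kernel e r c) * (M - s * d * F3 c))
        by (destruct Hs as [-> | ->]; ring).
      apply Rmult_le_pos; [exact HKc|].
      destruct Hs as [-> | ->], Hd as [-> | ->]; split_Rabs; lra. }
    assert (0 <= b - a) by lra.
    nra. }
generalize (Hsigned 1 (or_introl eq_refl)) (Hsigned (-1) (or_intror eq_refl)).
split_Rabs; lra.
Qed.

Definition quadrature_error (x : R) : R :=
  RInt F (-1) 1
  - 1 / 3 * ((1 + 3 * x) / (1 + x) * F (-1) + 4 / (1 - x ^ 2) * F x
             + (1 - 3 * x) / (1 - x) * F 1).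

(** K and K' vanish at -1 and 1 and agree from both sides at [x], so only K'' contributes: its end
    values and its jump at [x] give the three weights. *)
Lemma quadrature_error_by_parts (x : R) : -1 < x < 1 ->
  quadrature_error x =
  (by_parts (-1) (2 * x / (1 + x)) x - by_parts (-1) (2 * x / (1 + x)) (-1))
  + (by_parts 1 (2 * x / (1 - x)) 1 - by_parts 1 (2 * x / (1 - x)) x).
Proof.
intros Hx; unfold quadrature_error, by_parts, kernel.
rewrite RInt_point; change zero with 0.
field; repeat split; nra.
Qed.

Lemma quadrature_error_bound_nonneg (x : R) :
  0 <= x < 1 -> Rabs (quadrature_error x) <= M2_nonneg x * M.
Proof.
intros Hx; rewrite quadrature_error_by_parts by lra.
assert (Ht1 : x <= 2 * x / (1 + x)) by (apply Rle_div_r; nra).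
assert (Ht0 : x <= 2 * x / (1 - x)) by (apply Rle_div_r; nra).
assert (HL := by_parts_bound 1 (-1) (2 * x / (1 + x)) (-1) x
  ltac:(lra) ltac:(lra) ltac:(intros; lra) (or_introl eq_refl)).
unfold M2_nonneg; destruct Rlt_dec as [Hlt|Hge].
(* The sign change [t0] lies in [x,1], so the right piece is split there. *)
- assert (Ht0' : 2 * x / (1 - x) <= 1) by (apply Rle_div_l; lra).
  assert (HR1 := by_parts_bound 1 1 (2 * x / (1 - x)) x (2 * x / (1 - x))
    ltac:(lra) ltac:(lra) ltac:(intros; lra) (or_introl eq_refl)).
  assert (HR2 := by_parts_bound (-1) 1 (2 * x / (1 - x)) (2 * x / (1 - x)) 1
    ltac:(lra) ltac:(lra) ltac:(intros; lra) (or_intror eq_refl)).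
  replace ((8 * x ^ 5 + 49 * x ^ 4 - 60 * x ^ 3 + 22 * x ^ 2 - 4 * x + 1)
           / (36 * (1 - x) ^ 4) * M)
    with (1 * M * (kernel_primitive (-1) (2 * x / (1 + x)) x
                   - kernel_primitive (-1) (2 * x / (1 + x)) (-1))
          + 1 * M * (kernel_primitive 1 (2 * x / (1 - x)) (2 * x / (1 - x))
                     - kernel_primitive 1 (2 * x / (1 - x)) x)
          + -1 * M * (kernel_primitive 1 (2 * x / (1 - x)) 1
                     - kernel_primitive 1 (2 * x / (1 - x)) (2 * x / (1 - x))))
    by (unfold kernel_primitive; field; lra).
  split_Rabs; lra.
(* Now K >= 0 throughout, and its integral 2x/9 is the error of the rule on t^3/6. *)
- assert (Ht0' : 1 <= 2 * x / (1 - x)) by (apply Rle_div_r; lra).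
  assert (HR := by_parts_bound 1 1 (2 * x / (1 - x)) x 1
    ltac:(lra) ltac:(lra) ltac:(intros; lra) (or_introl eq_refl)).
  replace (2 * x / 9 * M)
    with (1 * M * (kernel_primitive (-1) (2 * x / (1 + x)) x
                   - kernel_primitive (-1) (2 * x / (1 + x)) (-1))
          + 1 * M * (kernel_primitive 1 (2 * x / (1 - x)) 1
                     - kernel_primitive 1 (2 * x / (1 - x)) x))
    by (unfold kernel_primitive; field; lra).
  split_Rabs; lra.
Qed.

End Kernel.

(** * Reflection to negative nodes *)

Lemma continuity_reflect (c : R) (g : R -> R) :
  (forall t, continuity_pt g t) ->
  forall t, continuity_pt (fun s => c * g (- s)) t.
Proof.
intros Hg t; apply (continuity_pt_scal (fun s => g (- s))).
apply (continuity_pt_comp Ropp g); [|apply Hg].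
apply continuity_pt_opp, continuity_pt_id.
Qed.

(** The factor [c] carries the sign gained at each differentiation, so the lemma can be iterated. *)
Lemma is_derive_reflect (c : R) (g d : R -> R) :
  (forall t, -1 < t < 1 -> is_derive g t (d t)) ->
  forall t, -1 < t < 1 -> is_derive (fun s => c * g (- s)) t (- c * d (- t)).
Proof.
intros Hg t Ht.
specialize (Hg (- t) ltac:(lra)).
auto_derive.
- eexists; exact Hg.
- replace (Derive (fun s : R => g s) (- t)) with (d (- t))
    by (symmetry; apply is_derive_unique, Hg).
  ring.
Qed.

(** Reflection preserves the integral and exchanges the two end weights of the rule. *)
Lemma quadrature_error_reflect (F : R -> R) (x : R) :
  (forall t, continuity_pt F t) -> -1 < x < 1 ->
  quadrature_error (fun t => 1 * F (- t)) (- x) = quadrature_error F x.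
Proof.
intros CF Hx; unfold quadrature_error.
assert (HI : RInt (fun t => 1 * F (- t)) (-1) 1 = RInt F (-1) 1).
{ set (G := fun t => 1 * F (- t)).
  assert (HG : forall a b, ex_RInt G a b)
    by (apply ex_RInt_F, continuity_reflect, CF).
  assert (Hlin := RInt_comp_lin (V := R_CompleteNormedModule) F (-1) 0 1 (-1)
    (ex_RInt_F F CF _ _)).
  replace (-1 * 1 + 0) with (-1) in Hlin by ring.
  replace (-1 * -1 + 0) with 1 in Hlin by ring.
  rewrite <- Hlin, <- (opp_RInt_swap (V := R_CompleteNormedModule) G) by apply HG.
  transitivity (RInt (fun y => scal (-1) (G y)) 1 (-1)).
  - rewrite (RInt_scal (V := R_CompleteNormedModule)) by apply HG.
    unfold opp, scal; simpl; unfold mult; simpl; ring.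
  - apply RInt_ext; intros y _; unfold G, scal; simpl; unfold mult; simpl.
    replace (-1 * y + 0) with (- y) by ring; ring. }
rewrite HI, Ropp_involutive.
replace (- -1) with 1 by ring.
change (- (1)) with (-1).
field; repeat split; nra.
Qed.

Lemma quadrature_error_bound (F F1 F2 F3 : R -> R) (M x : R) :
  (forall t, continuity_pt F t) ->
  (forall t, continuity_pt F1 t) ->
  (forall t, continuity_pt F2 t) ->
  (forall t, -1 < t < 1 -> is_derive F t (F1 t)) ->
  (forall t, -1 < t < 1 -> is_derive F1 t (F2 t)) ->
  (forall t, -1 < t < 1 -> is_derive F2 t (F3 t)) ->
  (forall t, -1 <= t <= 1 -> Rabs (F3 t) <= M) ->
  -1 < x < 1 -> Rabs (quadrature_error F x) <= M2 x * M.
Proof.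
intros CF CF1 CF2 DF DF1 DF2 BF3 Hx.
unfold M2; destruct Rle_dec as [H0|H0].
- apply (quadrature_error_bound_nonneg F F1 F2 F3); auto; lra.
- rewrite <- quadrature_error_reflect by assumption.
  (* The signs stay unreduced to match [is_derive_reflect] syntactically. *)
  apply (quadrature_error_bound_nonneg (fun t => 1 * F (- t))
    (fun t => - (1) * F1 (- t)) (fun t => - - (1) * F2 (- t))
    (fun t => - - - (1) * F3 (- t)));
    try apply continuity_reflect; try apply is_derive_reflect; try assumption.
  + intros t Ht; rewrite Rabs_mult.
    specialize (BF3 (- t) ltac:(lra)); split_Rabs; lra.
  + lra.
Qed.

Theorem mainTheorem1 :
  forall (x : R) (f f1 f2 f3 : R -> R),
    -1 < x < 1 ->
    is_derivative_on_I11 f f1 ->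
    is_derivative_on_I11 f1 f2 ->
    is_derivative_on_I11 f2 f3 ->
    bounded_on_I11 f3 ->
    Rabs (RInt f (-1) 1
          - 1 / 3 * ((1 + 3 * x) / (1 + x) * f (-1)
                     + 4 / (1 - x ^ 2) * f x
                     + (1 - 3 * x) / (1 - x) * f 1))
    <= M2 x * sup_norm f3.
Proof.
intros x f f1 f2 f3 Hx H0 H1 H2 H3.
assert (Hclamp : forall g d, is_derivative_on_I11 g d ->
  forall t, -1 < t < 1 -> is_derive (fun s => g (clamp s)) t (d (clamp t))).
{ intros g d Hg t Ht; rewrite clamp_id by (unfold I11; lra).
  apply is_derivative_on_I11_is_derive_clamp; assumption. }
assert (H := quadrature_error_bound (fun t => f (clamp t))
  (fun t => f1 (clamp t)) (fun t => f2 (clamp t)) (fun t => f3 (clamp t))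
  (sup_norm f3) x
  (is_derivative_on_I11_continuity_clamp _ _ H0)
  (is_derivative_on_I11_continuity_clamp _ _ H1)
  (is_derivative_on_I11_continuity_clamp _ _ H2)
  (Hclamp _ _ H0) (Hclamp _ _ H1) (Hclamp _ _ H2)
  (fun t _ => bounded_on_I11_le_sup_norm f3 H3 _ (clamp_I11 t)) Hx).
unfold quadrature_error in H.
(* The nodes and the range of integration lie in [-1,1], so every [clamp] disappears. *)
rewrite !clamp_id in H by (unfold I11; lra).
rewrite (RInt_ext (fun t => f (clamp t)) f) in H; [exact H|].
rewrite Rmin_left, Rmax_right by lra.
intros t Ht; rewrite clamp_id by (unfold I11; lra); reflexivity.
Qed.
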